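(* There exists a (simple) polygon with exactly $22$ edges containing a pair of points that do not illuminate each other. Consequently, the minimal number of edges of a polygon having at least one pair of points that do not illuminate each other is at most $22$.
   Context: A billiard trajectory in a polygon is a path of straight segments inside the polygon reflecting off the interiors of edges with angle of incidence equal to angle of reflection (stopping upon hitting a vertex). Two points illuminate each other if some billiard trajectory connects them. *)

(* Defs.v *)
From Stdlib Require Import Reals List.
Import ListNotations.
Open Scope R_scope.

Definition pt : Type := (R * R)%type.

Definition padd (p q : pt) : pt := (fst p + fst q, snd p + snd q).
Definition psub (p q : pt) : pt := (fst p - fst q, snd p - snd q).
Definition pscal (t : R) (p : pt) : pt := (t * fst p, t * snd p).
Definition dot (p q : pt) : R := fst p * fst q + snd p * snd q.
Definition norm2 (p : pt) : R := dot p p.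

Definition on_seg (a b p : pt) : Prop :=
  exists t, 0 <= t <= 1 /\ p = padd a (pscal t (psub b a)).
Definition in_open_seg (a b p : pt) : Prop :=
  exists t, 0 < t < 1 /\ p = padd a (pscal t (psub b a)).

Definition collinear (a b c : pt) : Prop :=
  (fst b - fst a) * (snd c - snd a) - (snd b - snd a) * (fst c - fst a) = 0.

(** A polygon with n edges is given by v : nat -> pt; its vertices are
    v 0, ..., v (n-1), indices taken modulo n; edge i joins vertex i and
    vertex i+1 (mod n). *)
Definition vtx (n : nat) (v : nat -> pt) (i : nat) : pt := v (Nat.modulo i n).

(** Simple polygon with exactly n edges: n >= 3, distinct vertices, no two
    consecutive edges collinear (so there are genuinely n edges/corners), and
    two distinct edges meet only when adjacent, and then only at their common
    vertex. *)
Definition simple_polygon (n : nat) (v : nat -> pt) : Prop :=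
  (3 <= n)%nat /\
  (forall i j, (i < n)%nat -> (j < n)%nat -> i <> j -> v i <> v j) /\
  (forall i, (i < n)%nat ->
     ~ collinear (vtx n v i) (vtx n v (S i)) (vtx n v (S (S i)))) /\
  (forall i j p, (i < n)%nat -> (j < n)%nat -> i <> j ->
     on_seg (vtx n v i) (vtx n v (S i)) p ->
     on_seg (vtx n v j) (vtx n v (S j)) p ->
     (j = Nat.modulo (S i) n /\ p = vtx n v j) \/
     (i = Nat.modulo (S j) n /\ p = vtx n v i)).

Definition on_boundary (n : nat) (v : nat -> pt) (p : pt) : Prop :=
  exists i, (i < n)%nat /\ on_seg (vtx n v i) (vtx n v (S i)) p.

Definition seg_avoids (n : nat) (v : nat -> pt) (a b : pt) : Prop :=
  forall p, on_seg a b p -> ~ on_boundary n v p.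

Fixpoint path_avoids (n : nat) (v : nat -> pt) (p : pt) (ms : list pt) (q : pt)
  : Prop :=
  match ms with
  | [] => seg_avoids n v p q
  | m :: ms' => seg_avoids n v p m /\ path_avoids n v m ms' q
  end.

(** p lies in the unbounded component of the complement of the boundary:
    it can be joined, avoiding the boundary, to points arbitrarily far away. *)
Definition in_exterior (n : nat) (v : nat -> pt) (p : pt) : Prop :=
  forall r : R, exists q ms, r < norm2 q /\ path_avoids n v p ms q.

Definition in_interior (n : nat) (v : nat -> pt) (p : pt) : Prop :=
  ~ on_boundary n v p /\ ~ in_exterior n v p.

(** Reflection of vector u across a line with direction d. *)
Definition reflect_vec (d u : pt) : pt :=
  psub (pscal (2 * dot u d / dot d d) d) u.

Definition good_seg (n : nat) (v : nat -> pt) (a b : pt) : Prop :=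
  a <> b /\ forall p, in_open_seg a b p -> in_interior n v p.

Definition reflects (n : nat) (v : nat -> pt) (a p b : pt) : Prop :=
  exists i, (i < n)%nat /\ in_open_seg (vtx n v i) (vtx n v (S i)) p /\
    exists t, 0 < t /\
      psub b p = pscal t (reflect_vec (psub (vtx n v (S i)) (vtx n v i))
                                      (psub p a)).

Fixpoint segs_ok (n : nat) (v : nat -> pt) (s : list pt) : Prop :=
  match s with
  | a :: ((b :: _) as t) => good_seg n v a b /\ segs_ok n v t
  | _ => True
  end.

Fixpoint refls_ok (n : nat) (v : nat -> pt) (s : list pt) : Prop :=
  match s with
  | a :: ((p :: b :: _) as t) => reflects n v a p b /\ refls_ok n v t
  | _ => True
  end.

Definition billiard_trajectory (n : nat) (v : nat -> pt) (x : pt) (ms : list pt)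
  (y : pt) : Prop :=
  segs_ok n v (x :: ms ++ [y]) /\ refls_ok n v (x :: ms ++ [y]).

Definition illuminates (n : nat) (v : nat -> pt) (x y : pt) : Prop :=
  exists ms, billiard_trajectory n v x ms y.

(* Main.v *)
(** Let Q be the staircase of the five unit squares with lower left corners
    (0,-1), (0,0), (1,0), (1,1), (2,1), numbered 1 to 5.  The 22-gon P is the
    union of Q with its mirror images in the lines x = 0 and y = 2, so P folds
    onto Q.  A trajectory from (0,0) unfolds to a straight line from the origin,
    and the folded trajectory moves to a neighbouring square of Q, or stays,
    according only to the kind (horizontal or vertical) and the parity of the
    grid line that the unfolded line crosses.  Every integer point of Q other
    than (0,0) and (2,2) is a corner of Q.  The first
    lattice point met by the unfolded line is not even-even, hence the
    trajectory either hits a vertex of P there or reaches one of (0,1), (0,-1),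
    (1,2), (3,2), where the folded trajectory turns back on itself.  In the second
    case it retraces its squares and is back in square 1 or 2, at the source, when
    the unfolded line reaches its next even-even point; by induction this holds
    at every even-even point, whereas the squares around the target (2,2) fold
    to 4 and 5. *)

Require Import Defs.
From Stdlib Require Import Reals List.
From Stdlib Require Import ZArith Lia Lra Bool Classical.
Import ListNotations.
Open Scope R_scope.

(** * The folded dynamics on the five squares *)

Definition swap (a b s : nat) : nat :=
  if Nat.eqb s a then b else if Nat.eqb s b then a else s.

(** Squares 4 and 5 of Q share a side on x = 2, squares 2 and 3 on x = 1, squares 1 and 2 on y = 0,
    squares 3 and 4 on y = 1. Every other side of a square is a wall or a mirror of the folding,
    where the number is kept. *)
Definition cross_vertical (even : bool) : nat -> nat :=
  if even then swap 4 5 else swap 2 3.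
Definition cross_horizontal (even : bool) : nat -> nat :=
  if even then swap 1 2 else swap 3 4.
(** A path through (0,0) passes between squares 1 and 2, one through (2,2) between 4 and 5; hence
    two disjoint swaps. At the other lattice points that are not vertices the path is turned back
    into its own square. *)
Definition cross_corner (evenx eveny : bool) (s : nat) : nat :=
  if evenx && eveny then swap 1 2 (swap 4 5 s) else s.

(* The unfolded line is [(u / n, u / m)] at time [u], so it meets a vertical
   grid line when [n] divides [u] and a horizontal one when [m] does.  At a point
   with an odd coordinate that is a vertex of the polygon the value is junk. *)
Definition event (n m u s : nat) : nat :=
  match Nat.eqb (u mod n) 0, Nat.eqb (u mod m) 0 with
  | true, true => cross_corner (Nat.even (u / n)) (Nat.even (u / m)) s
  | true, false => cross_vertical (Nat.even (u / n)) s
  | false, true => cross_horizontal (Nat.even (u / m)) s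
  | false, false => s
  end.

Fixpoint itinerary (n m s u : nat) : nat :=
  match u with
  | O => s
  | S u' => event n m u (itinerary n m s u')
  end.

Lemma swap_involutive a b s : swap a b (swap a b s) = s.
Proof.
  unfold swap.
  destruct (Nat.eqb_spec s a) as [->|Ha].
  - destruct (Nat.eqb_spec b a) as [->|_]; [reflexivity|].
    now rewrite Nat.eqb_refl.
  - destruct (Nat.eqb_spec s b) as [->|Hb].
    + now rewrite Nat.eqb_refl.
    + destruct (Nat.eqb_spec s a); [easy|].
      destruct (Nat.eqb_spec s b); easy.
Qed.

Lemma event_involutive n m u s :
  (u mod n <> 0 \/ u mod m <> 0)%nat -> event n m u (event n m u s) = s.
Proof.
  intro H; unfold event, cross_vertical, cross_horizontal.
  destruct (Nat.eqb_spec (u mod n) 0), (Nat.eqb_spec (u mod m) 0);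
    [lia| | |reflexivity];
    match goal with |- context [Nat.even ?x] => destruct (Nat.even x) end;
    apply swap_involutive.
Qed.

Lemma mod_mirror n t j :
  (n <> 0 -> t mod n = 0 -> j <= t ->
   ((t + j) mod n = 0 <-> (t - j) mod n = 0))%nat.
Proof.
  intros Hn Ht Hj.
  rewrite !Nat.Lcm0.mod_divide in *.
  destruct Ht as [q Hq].
  split; intros [r Hr].
  - exists (2 * q - r)%nat. rewrite Nat.mul_sub_distr_r. lia.
  - exists (2 * q - r)%nat. rewrite Nat.mul_sub_distr_r. lia.
Qed.

Lemma even_div_mirror n t j :
  (n <> 0 -> t mod n = 0 -> j <= t -> (t + j) mod n = 0 ->
   Nat.even ((t + j) / n) = Nat.even ((t - j) / n))%nat.
Proof.
  intros Hn Ht Hj Hm.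
  pose proof (proj1 (mod_mirror n t j Hn Ht Hj) Hm) as Hm'.
  apply Nat.Lcm0.mod_divide in Ht as [q Hq].
  apply Nat.Lcm0.mod_divide in Hm as [r Hr].
  apply Nat.Lcm0.mod_divide in Hm' as [r' Hr'].
  rewrite Hr, Hr', !Nat.div_mul by easy.
  assert (E : (r + r' = 2 * q)%nat) by nia.
  assert (Ev : Nat.even (r + r') = true) by (rewrite E, Nat.even_mul; easy).
  rewrite Nat.even_add in Ev.
  destruct (Nat.even r), (Nat.even r'); easy.
Qed.

(** The quotients of t + j and t - j by n add up to the even number 2 (t / n), so grid lines met
    symmetrically about a lattice time have the same kind and parity. *)
Lemma event_mirror n m t j s :
  (n <> 0 -> m <> 0 -> t mod n = 0 -> t mod m = 0 -> j <= t ->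
   event n m (t + j) s = event n m (t - j) s)%nat.
Proof.
  intros Hn Hm Hnt Hmt Hj; unfold event.
  pose proof (mod_mirror n t j Hn Hnt Hj) as En.
  pose proof (mod_mirror m t j Hm Hmt Hj) as Em.
  pose proof (even_div_mirror n t j Hn Hnt Hj) as Fn.
  pose proof (even_div_mirror m t j Hm Hmt Hj) as Fm.
  destruct (Nat.eqb_spec ((t + j) mod n) 0) as [a|a],
           (Nat.eqb_spec ((t + j) mod m) 0) as [b|b],
           (Nat.eqb_spec ((t - j) mod n) 0) as [c|c],
           (Nat.eqb_spec ((t - j) mod m) 0) as [d|d];
    try tauto; rewrite ?(Fn a), ?(Fm b); reflexivity.
Qed.

Definition home (s : nat) : Prop := s = 1%nat \/ s = 2%nat.

(* [lcm n m] is the first time the line meets a lattice point, and that point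
   has an odd coordinate. *)
Lemma lcm_quotients_not_both_even n m :
  (n <> 0 -> m <> 0 ->
   ~ (Nat.even (Nat.lcm n m / n) = true /\ Nat.even (Nat.lcm n m / m) = true))%nat.
Proof.
  intros Hn Hm [En Em].
  pose proof (Nat.divide_lcm_l n m) as [q Hq].
  pose proof (Nat.divide_lcm_r n m) as [r Hr].
  rewrite Hq, Nat.div_mul in En by easy.
  rewrite Hr, Nat.div_mul in Em by easy.
  apply Nat.even_spec in En as [q' ->]; apply Nat.even_spec in Em as [r' ->].
  assert (Hc : (q' * n = r' * m)%nat) by nia.
  (* Half the lcm would already be a common multiple, hence a multiple of the lcm. *)
  assert (Hd : Nat.divide (Nat.lcm n m) (q' * n)).
  { apply Nat.lcm_least; [now exists q'|]. exists r'. lia. }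
  destruct Hd as [z Hz].
  assert (Nat.lcm n m <> 0)%nat by (rewrite Nat.lcm_eq_0; lia).
  assert (q' * n <> 0)%nat by lia.
  destruct z; nia.
Qed.

Section Period.
Variables n m s0 : nat.
Hypothesis n_pos : n <> 0%nat.
Hypothesis m_pos : m <> 0%nat.
Let w := Nat.lcm n m.
Let sigma := itinerary n m s0.

Lemma lcm_mod_l k : ((k * w) mod n = 0)%nat.
Proof.
  apply Nat.Lcm0.mod_divide, Nat.divide_mul_r, Nat.divide_lcm_l.
Qed.

Lemma lcm_mod_r k : ((k * w) mod m = 0)%nat.
Proof.
  apply Nat.Lcm0.mod_divide, Nat.divide_mul_r, Nat.divide_lcm_r.
Qed.

Lemma lcm_pos : (0 < w)%nat.
Proof. assert (w <> 0)%nat by (unfold w; rewrite Nat.lcm_eq_0; lia). lia. Qed.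

Lemma event_lcm k s :
  event n m (k * w) s =
  cross_corner (Nat.even (k * (w / n))) (Nat.even (k * (w / m))) s.
Proof.
  unfold event; rewrite lcm_mod_l, lcm_mod_r; cbn [Nat.eqb].
  rewrite !Nat.Lcm0.divide_div_mul_exact;
    [reflexivity|apply Nat.divide_lcm_r|apply Nat.divide_lcm_l].
Qed.

(** One of the two quotients of the lcm is odd and stays odd after multiplication by an odd number,
    so the lattice point is not even-even. *)
Lemma event_odd_lcm k s : event n m ((2 * k + 1) * w) s = s.
Proof.
  rewrite event_lcm, !Nat.even_mul, Nat.even_add, Nat.even_mul.
  unfold cross_corner; cbn.
  pose proof (lcm_quotients_not_both_even n m n_pos m_pos) as H; fold w in H.
  destruct (Nat.even (w / n)), (Nat.even (w / m)); tauto.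
Qed.

Lemma home_event_even_lcm k s : home s -> home (event n m (2 * k * w) s).
Proof.
  rewrite event_lcm, !Nat.even_mul; cbn.
  intros [-> | ->]; [right|left]; reflexivity.
Qed.

Lemma not_both_lcm k j :
  (0 < j < w -> (k * w + j) mod n <> 0 \/ (k * w + j) mod m <> 0)%nat.
Proof.
  intros Hj.
  destruct (Nat.eq_dec ((k * w + j) mod n) 0) as [a|a]; [|now left].
  destruct (Nat.eq_dec ((k * w + j) mod m) 0) as [b|b]; [|now right].
  exfalso.
  apply Nat.Lcm0.mod_divide in a; apply Nat.Lcm0.mod_divide in b.
  pose proof (Nat.lcm_least _ _ _ a b) as [z Hz]; fold w in Hz.
  destruct (Nat.le_gt_cases z k); nia.
Qed.

(** After the turning point at t, an odd multiple of [w], each event repeats its mirror event before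
    t, and events are involutions, so the squares are retraced. As [sigma u] is the square occupied
    between the times u and u + 1, the mirror image of index t + j is t - 1 - j. *)
Lemma itinerary_palindrome k j :
  (j < w)%nat ->
  sigma ((2 * k + 1) * w + j) = sigma ((2 * k + 1) * w - 1 - j).
Proof.
  pose proof lcm_pos as Hw.
  induction j as [|j IH]; intro Hj.
  - replace ((2 * k + 1) * w + 0)%nat with (S ((2 * k + 1) * w - 1 - 0)) by nia.
    change (sigma (S ?u)) with (event n m (S u) (sigma u)).
    replace (S ((2 * k + 1) * w - 1 - 0)) with ((2 * k + 1) * w)%nat by nia.
    apply event_odd_lcm.
  - set (t := ((2 * k + 1) * w)%nat) in *.
    assert (Ht : (w <= t)%nat) by (unfold t; nia).
    replace (t + S j)%nat with (S (t + j)) by lia.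
    change (sigma (S ?u)) with (event n m (S u) (sigma u)).
    rewrite IH by lia.
    replace (t - 1 - j)%nat with (S (t - 1 - S j)) by lia.
    change (sigma (S ?u)) with (event n m (S u) (sigma u)).
    replace (S (t + j)) with (t + S j)%nat by lia.
    replace (S (t - 1 - S j)) with (t - S j)%nat by lia.
    rewrite event_mirror;
      [|easy|easy|apply lcm_mod_l|apply lcm_mod_r|lia].
    apply event_involutive.
    replace (t - S j)%nat with (2 * k * w + (w - S j))%nat by (unfold t; nia).
    apply not_both_lcm; lia.
Qed.

(** The palindrome with j = w - 1 carries the square just after one even multiple of [w] to the
    square just before the next, where the event only swaps 1 and 2. *)
Lemma home_even_lcm k : home s0 ->
  home (sigma (2 * k * w)) /\ home (sigma (2 * (k + 1) * w - 1)).
Proof.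
  intro H0. pose proof lcm_pos as Hw.
  assert (Hstep : forall k, sigma (2 * (k + 1) * w - 1) = sigma (2 * k * w)).
  { intro i.
    replace (2 * (i + 1) * w - 1)%nat with ((2 * i + 1) * w + (w - 1))%nat by nia.
    rewrite itinerary_palindrome by lia. f_equal. nia. }
  rewrite Hstep.
  induction k as [|k [IH _]]; [now split|].
  assert (H : home (sigma (2 * S k * w))); [|now split].
  replace (2 * S k * w)%nat with (S (2 * (k + 1) * w - 1)) by nia.
  change (sigma (S ?u)) with (event n m (S u) (sigma u)).
  replace (S (2 * (k + 1) * w - 1)) with (2 * S k * w)%nat by nia.
  apply home_event_even_lcm. now rewrite Hstep.
Qed.

(** Halving an even-even time gives a common multiple of [n] and [m], so the time is an even
    multiple of the lcm. *)
Lemma home_before_even_point a b v :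
  home s0 -> (0 < v)%nat -> (v = 2 * a * n)%nat -> (v = 2 * b * m)%nat ->
  home (sigma (v - 1)).
Proof.
  intros H0 Hv Ha Hb.
  assert (Hd : Nat.divide w (a * n)).
  { apply Nat.lcm_least; [now exists a|exists b; lia]. }
  destruct Hd as [z Hz].
  destruct z as [|z]; [lia|].
  replace v with (2 * (z + 1) * w)%nat by lia.
  now apply home_even_lcm.
Qed.

End Period.

(** * The polygon *)

Open Scope Z_scope.
(** Listed counterclockwise. The two mirror images of the staircase come from x -> -x and y -> 4 -
    y. *)
Definition corners : list (Z * Z) :=
  [(1,-1); (1,0); (2,0); (2,1); (3,1); (3,3); (2,3); (2,4); (1,4); (1,5);
   (0,5); (0,3); (1,3); (1,1); (-1,1); (-1,2); (-3,2); (-3,1); (-2,1);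
   (-2,0); (-1,0); (-1,-1)].

Definition corner (i : nat) : Z * Z := nth i corners (0, 0).
Definition edge (i : nat) : (Z * Z) * (Z * Z) :=
  (corner (i mod 22), corner (S i mod 22)).
Definition edges : list ((Z * Z) * (Z * Z)) := map edge (seq 0 22).

Definition embed (c : Z * Z) : pt := (IZR (fst c), IZR (snd c)).
Definition gon22 (i : nat) : pt := embed (corner i).

(* A cell is a doubled coordinate: [2k] stands for the integer [k], and
   [2k+1] for the open interval between [k] and [k+1]. *)
Definition cell (x : R) (c : Z) : Prop :=
  (exists k, c = 2 * k /\ x = IZR k) \/
  (exists k, c = 2 * k + 1 /\ (IZR k < x < IZR (k + 1))%R).

(** An axis-parallel edge equals its bounding box, so membership amounts to integer inequalities
    between cells. *)
Definition edge_closed (e : (Z * Z) * (Z * Z)) (cx cy : Z) : bool :=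
  let '((x1, y1), (x2, y2)) := e in
  (2 * Z.min x1 x2 <=? cx) && (cx <=? 2 * Z.max x1 x2) &&
  (2 * Z.min y1 y2 <=? cy) && (cy <=? 2 * Z.max y1 y2).

Definition vertical_open (e : (Z * Z) * (Z * Z)) (cx cy : Z) : bool :=
  let '((x1, y1), (x2, y2)) := e in
  (x1 =? x2) && (cx =? 2 * x1) && (2 * Z.min y1 y2 <? cy) && (cy <? 2 * Z.max y1 y2).

Definition horizontal_open (e : (Z * Z) * (Z * Z)) (cx cy : Z) : bool :=
  let '((x1, y1), (x2, y2)) := e in
  (y1 =? y2) && (cy =? 2 * y1) && (2 * Z.min x1 x2 <? cx) && (cx <? 2 * Z.max x1 x2).

Definition boundary_cell (cx cy : Z) : bool :=
  existsb (fun e => edge_closed e cx cy) edges.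

Definition axis_parallel (e : (Z * Z) * (Z * Z)) : bool :=
  let '((x1, y1), (x2, y2)) := e in
  xorb (x1 =? x2) (y1 =? y2).

Lemma edges_axis_parallel : forallb axis_parallel edges = true.
Proof. vm_compute. reflexivity. Qed.

Close Scope Z_scope.

Lemma vtx_gon22 i : vtx 22 gon22 i = embed (corner (i mod 22)).
Proof. reflexivity. Qed.

Lemma edge_In i : (i < 22)%nat -> In (edge i) edges.
Proof. intro H. apply in_map, in_seq. lia. Qed.

Lemma edge_parallel i : (i < 22)%nat -> axis_parallel (edge i) = true.
Proof.
  intro H. apply (proj1 (forallb_forall _ _) edges_axis_parallel), edge_In, H.
Qed.

Lemma cell_exists x : exists c, cell x c.
Proof.
  destruct (archimed x) as [H1 H2].
  set (k := (up x - 1)%Z).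
  assert (Hk : IZR (up x) = IZR k + 1) by (unfold k; rewrite minus_IZR; lra).
  destruct (Req_dec x (IZR k)) as [E|E].
  - exists (2 * k)%Z. left. now exists k.
  - exists (2 * k + 1)%Z. right. exists k. split; [reflexivity|].
    rewrite plus_IZR. lra.
Qed.

(** A cell decides every comparison with an integer. This and its three companions turn geometric
    questions about the polygon into boolean computations. *)
Lemma cell_ge x c a : cell x c -> (IZR a <= x <-> (2 * a <= c)%Z).
Proof.
  intros [[k [-> ->]]|[k [-> [H1 H2]]]].
  - split; intro H.
    + apply le_IZR in H. lia.
    + apply IZR_le. lia.
  - split; intro H.
    + assert (IZR a < IZR (k + 1)) by lra. apply lt_IZR in H0. lia.
    + assert (IZR a <= IZR k) by (apply IZR_le; lia). lra.
Qed.

Lemma cell_le x c a : cell x c -> (x <= IZR a <-> (c <= 2 * a)%Z).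
Proof.
  intros [[k [-> ->]]|[k [-> [H1 H2]]]].
  - split; intro H.
    + apply le_IZR in H. lia.
    + apply IZR_le. lia.
  - split; intro H.
    + assert (IZR k < IZR a) by lra. apply lt_IZR in H0. lia.
    + assert (IZR (k + 1) <= IZR a) by (apply IZR_le; lia). lra.
Qed.

Lemma cell_lt x c a : cell x c -> (x < IZR a <-> (c < 2 * a)%Z).
Proof.
  intro H. pose proof (cell_ge x c a H) as E.
  split; intro L.
  - apply Z.nle_gt. intro F. apply E in F. lra.
  - apply Rnot_le_lt. intro F. apply E in F. lia.
Qed.

Lemma cell_gt x c a : cell x c -> (IZR a < x <-> (2 * a < c)%Z).
Proof.
  intro H. pose proof (cell_le x c a H) as E.
  split; intro L.
  - apply Z.nle_gt. intro F. apply E in F. lra.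
  - apply Rnot_le_lt. intro F. apply E in F. lia.
Qed.

Lemma cell_IZR k : cell (IZR k) (2 * k).
Proof. left. now exists k. Qed.

Lemma between_param a b x :
  Rmin a b <= x <= Rmax a b -> a <> b ->
  exists t, 0 <= t <= 1 /\ x = a + t * (b - a).
Proof.
  intros H Hab. exists ((x - a) / (b - a)).
  split; [|field; lra].
  destruct (Rle_lt_dec a b) as [L|L].
  - rewrite Rmin_left, Rmax_right in H by lra.
    split; [apply Rmult_le_pos; [lra|left; apply Rinv_0_lt_compat; lra]|].
    apply Rmult_le_reg_r with (b - a); [lra|]. field_simplify; lra.
  - rewrite Rmin_right, Rmax_left in H by lra.
    replace ((x - a) / (b - a)) with ((a - x) / (a - b)) by (field; lra).
    split; [apply Rmult_le_pos; [lra|left; apply Rinv_0_lt_compat; lra]|].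
    apply Rmult_le_reg_r with (a - b); [lra|]. field_simplify; lra.
Qed.

Lemma param_between a b t :
  0 <= t <= 1 -> Rmin a b <= a + t * (b - a) <= Rmax a b.
Proof.
  intro H. unfold Rmin, Rmax.
  destruct (Rle_dec a b); split; nra.
Qed.

Lemma param_strictly_between a b t :
  0 < t < 1 -> a <> b -> Rmin a b < a + t * (b - a) < Rmax a b.
Proof.
  intros H Hab. unfold Rmin, Rmax.
  destruct (Rle_dec a b); split; nra.
Qed.

Lemma Rmin_IZR a b : Rmin (IZR a) (IZR b) = IZR (Z.min a b).
Proof.
  destruct (Z.le_ge_cases a b) as [H|H].
  - rewrite Z.min_l, Rmin_left; auto. now apply IZR_le.
  - rewrite Z.min_r, Rmin_right; auto. now apply IZR_le.
Qed.

Lemma Rmax_IZR a b : Rmax (IZR a) (IZR b) = IZR (Z.max a b).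
Proof.
  destruct (Z.le_ge_cases a b) as [H|H].
  - rewrite Z.max_r, Rmax_right; auto. now apply IZR_le.
  - rewrite Z.max_l, Rmax_left; auto. now apply IZR_le.
Qed.

Lemma on_seg_closed e p cx cy :
  on_seg (embed (fst e)) (embed (snd e)) p ->
  cell (fst p) cx -> cell (snd p) cy -> edge_closed e cx cy = true.
Proof.
  destruct e as [[x1 y1] [x2 y2]]; unfold on_seg; cbn -[Z.mul].
  intros [t [Ht ->]] Hx Hy; cbn in Hx, Hy.
  pose proof (param_between (IZR x1) (IZR x2) t Ht) as Bx.
  pose proof (param_between (IZR y1) (IZR y2) t Ht) as By.
  rewrite Rmin_IZR, Rmax_IZR in Bx, By.
  rewrite !andb_true_iff, !Z.leb_le.
  rewrite <- (cell_ge _ _ _ Hx), <- (cell_le _ _ _ Hx).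
  rewrite <- (cell_ge _ _ _ Hy), <- (cell_le _ _ _ Hy).
  tauto.
Qed.

Lemma closed_on_seg e p cx cy :
  axis_parallel e = true ->
  cell (fst p) cx -> cell (snd p) cy -> edge_closed e cx cy = true ->
  on_seg (embed (fst e)) (embed (snd e)) p.
Proof.
  destruct e as [[x1 y1] [x2 y2]], p as [px py]; unfold on_seg; cbn -[Z.mul].
  intros Hp Hx Hy He.
  rewrite !andb_true_iff, !Z.leb_le in He.
  rewrite <- (cell_ge _ _ _ Hx), <- (cell_le _ _ _ Hx) in He.
  rewrite <- (cell_ge _ _ _ Hy), <- (cell_le _ _ _ Hy) in He.
  rewrite <- !Rmin_IZR, <- !Rmax_IZR in He.
  destruct He as [[[A1 A2] A3] A4].
  destruct (Z.eqb_spec x1 x2) as [E|E], (Z.eqb_spec y1 y2) as [F|F]; try easy.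
  - assert (G : IZR y1 <> IZR y2) by now apply eq_IZR_contrapositive.
    destruct (between_param _ _ py (conj A3 A4) G) as [t [Ht Et]].
    subst x2. rewrite Rmin_left in A1 by lra. rewrite Rmax_left in A2 by lra.
    exists t; split; [exact Ht|].
    unfold padd, pscal, psub, embed; cbn. f_equal; lra.
  - assert (G : IZR x1 <> IZR x2) by now apply eq_IZR_contrapositive.
    destruct (between_param _ _ px (conj A1 A2) G) as [t [Ht Et]].
    subst y2. rewrite Rmin_left in A3 by lra. rewrite Rmax_left in A4 by lra.
    exists t; split; [exact Ht|].
    unfold padd, pscal, psub, embed; cbn. f_equal; lra.
Qed.

Lemma on_boundary_cell p cx cy :
  cell (fst p) cx -> cell (snd p) cy ->
  (on_boundary 22 gon22 p <-> boundary_cell cx cy = true).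
Proof.
  intros Hx Hy. unfold on_boundary, boundary_cell.
  rewrite existsb_exists. split.
  - intros [i [Hi H]]. exists (edge i). split; [now apply edge_In|].
    rewrite !vtx_gon22 in H. now apply (on_seg_closed (edge i) p).
  - intros [e [He H]].
    apply in_map_iff in He as [i [<- Hi]]. apply in_seq in Hi.
    exists i. split; [lia|].
    rewrite !vtx_gon22. apply (closed_on_seg (edge i) p cx cy); auto.
    apply edge_parallel; lia.
Qed.

(** * Simplicity of the polygon *)

Lemma seq_forallb (f : nat -> bool) k :
  forallb f (seq 0 k) = true -> forall i, (i < k)%nat -> f i = true.
Proof.
  intros H i Hi. apply (proj1 (forallb_forall _ _) H), in_seq. lia.
Qed.

Definition Zpt_eqb (a b : Z * Z) : bool :=
  (Z.eqb (fst a) (fst b) && Z.eqb (snd a) (snd b))%bool.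

Lemma Zpt_eqb_spec a b : Zpt_eqb a b = true <-> a = b.
Proof.
  destruct a, b; unfold Zpt_eqb; cbn.
  rewrite andb_true_iff, !Z.eqb_eq. split; [intros [-> ->]|intros [= -> ->]]; easy.
Qed.

Lemma embed_inj a b : embed a = embed b -> a = b.
Proof.
  destruct a, b; unfold embed; cbn. intros [= H1 H2].
  apply eq_IZR in H1; apply eq_IZR in H2. congruence.
Qed.

(** Since edges are boxes, two of them meet in a box again; it is empty when a lower bound exceeds
    the corresponding upper one. *)
Definition box_meet (e f : (Z * Z) * (Z * Z)) : (Z * Z) * (Z * Z) :=
  let '((x1, y1), (x2, y2)) := e in
  let '((x3, y3), (x4, y4)) := f in
  ((Z.max (Z.min x1 x2) (Z.min x3 x4), Z.max (Z.min y1 y2) (Z.min y3 y4)),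
   (Z.min (Z.max x1 x2) (Z.max x3 x4), Z.min (Z.max y1 y2) (Z.max y3 y4))).

Lemma on_seg_box_meet e f p :
  on_seg (embed (fst e)) (embed (snd e)) p ->
  on_seg (embed (fst f)) (embed (snd f)) p ->
  IZR (fst (fst (box_meet e f))) <= fst p <= IZR (fst (snd (box_meet e f))) /\
  IZR (snd (fst (box_meet e f))) <= snd p <= IZR (snd (snd (box_meet e f))).
Proof.
  intros He Hf.
  destruct (cell_exists (fst p)) as [cx Hx], (cell_exists (snd p)) as [cy Hy].
  pose proof (on_seg_closed e p cx cy He Hx Hy) as Ce.
  pose proof (on_seg_closed f p cx cy Hf Hx Hy) as Cf.
  rewrite (cell_ge _ _ _ Hx), (cell_le _ _ _ Hx), (cell_ge _ _ _ Hy), (cell_le _ _ _ Hy).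
  destruct e as [[x1 y1] [x2 y2]], f as [[x3 y3] [x4 y4]]; cbn -[Z.mul] in *.
  rewrite !andb_true_iff, !Z.leb_le in Ce, Cf. lia.
Qed.

Definition edges_meet_well (i j : nat) : bool :=
  let b := box_meet (edge i) (edge j) in
  Nat.eqb i j ||
  (Z.ltb (fst (snd b)) (fst (fst b)) || Z.ltb (snd (snd b)) (snd (fst b))) ||
  (Zpt_eqb (fst b) (snd b) &&
   ((Nat.eqb j (S i mod 22) && Zpt_eqb (fst b) (corner (j mod 22))) ||
    (Nat.eqb i (S j mod 22) && Zpt_eqb (fst b) (corner (i mod 22))))).

Lemma edges_meet_well_all :
  forallb (fun i => forallb (edges_meet_well i) (seq 0 22)) (seq 0 22) = true.
Proof. vm_compute. reflexivity. Qed.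

Definition turns (i : nat) : bool :=
  let a := corner (i mod 22) in
  let b := corner (S i mod 22) in
  let c := corner (S (S i) mod 22) in
  negb (Z.eqb ((fst b - fst a) * (snd c - snd a) - (snd b - snd a) * (fst c - fst a)) 0).

Lemma turns_all : forallb turns (seq 0 22) = true.
Proof. vm_compute. reflexivity. Qed.

Lemma corners_distinct :
  forallb (fun i => forallb (fun j =>
    Nat.eqb i j || negb (Zpt_eqb (corner i) (corner j))) (seq 0 22)) (seq 0 22) = true.
Proof. vm_compute. reflexivity. Qed.

Lemma gon22_simple : simple_polygon 22 gon22.
Proof.
  split; [lia|]. split; [|split].
  - intros i j Hi Hj Hij E. apply embed_inj, Zpt_eqb_spec in E.
    pose proof (seq_forallb _ _ (seq_forallb _ _ corners_distinct i Hi) j Hj) as H.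
    cbv beta in H. rewrite E in H.
    destruct (Nat.eqb_spec i j); easy.
  - intros i Hi Hc.
    pose proof (seq_forallb _ _ turns_all i Hi) as H.
    unfold turns in H. rewrite negb_true_iff, Z.eqb_neq in H. apply H.
    unfold collinear in Hc. rewrite !vtx_gon22 in Hc. unfold embed in Hc.
    cbn [fst snd] in Hc. rewrite <- !minus_IZR, <- !mult_IZR, <- minus_IZR in Hc.
    now apply eq_IZR in Hc.
  - intros i j p Hi Hj Hij H1 H2. rewrite !vtx_gon22 in *.
    pose proof (on_seg_box_meet (edge i) (edge j) p H1 H2) as [Bx By].
    pose proof (seq_forallb _ _ (seq_forallb _ _ edges_meet_well_all i Hi) j Hj) as H.
    unfold edges_meet_well in H.
    set (b := box_meet (edge i) (edge j)) in *.
    destruct (Nat.eqb_spec i j) as [|_]; [easy|].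
    rewrite !orb_true_iff, andb_true_iff, orb_true_iff, !andb_true_iff,
      !Z.ltb_lt, !Zpt_eqb_spec, !Nat.eqb_eq in H.
    assert (P : fst b = snd b -> p = embed (fst b)).
    { intro E. rewrite <- E in Bx, By. unfold embed. destruct p; cbn in *.
      f_equal; lra. }
    destruct H as [[H|[H|H]]|[E [[H H']|[H H']]]].
    + discriminate.
    + apply IZR_lt in H. lra.
    + apply IZR_lt in H. lra.
    + left. split; [exact H|]. rewrite (P E). now f_equal.
    + right. split; [exact H|]. rewrite (P E). now f_equal.
Qed.

(** * The enclosed region *)

(* Open rectangles [(x1, y1), (x2, y2)] whose union is the region enclosed by
   the boundary, chosen so that their closures add only boundary points. *)
Definition rooms : list ((Z * Z) * (Z * Z)) :=
  [((-1,-1),(1,1)); ((-2,0),(2,1)); ((1,0),(2,4)); ((1,1),(3,3));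
   ((0,3),(2,4)); ((0,3),(1,5)); ((-2,0),(-1,2)); ((-3,1),(-1,2))]%Z.

Definition in_open_room (r : (Z * Z) * (Z * Z)) (p : pt) : Prop :=
  IZR (fst (fst r)) < fst p < IZR (fst (snd r)) /\
  IZR (snd (fst r)) < snd p < IZR (snd (snd r)).
Definition in_closed_room (r : (Z * Z) * (Z * Z)) (p : pt) : Prop :=
  IZR (fst (fst r)) <= fst p <= IZR (fst (snd r)) /\
  IZR (snd (fst r)) <= snd p <= IZR (snd (snd r)).
Definition inside (p : pt) : Prop := Exists (fun r => in_open_room r p) rooms.
Definition inside_closure (p : pt) : Prop := Exists (fun r => in_closed_room r p) rooms.

Definition open_room_cell (cx cy : Z) (r : (Z * Z) * (Z * Z)) : bool :=
  (Z.ltb (2 * fst (fst r)) cx && Z.ltb cx (2 * fst (snd r)) &&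
   Z.ltb (2 * snd (fst r)) cy && Z.ltb cy (2 * snd (snd r)))%bool.

Definition Zrange (lo : Z) (len : nat) : list Z :=
  map (fun i => (lo + Z.of_nat i)%Z) (seq 0 len).

Lemma Zrange_In lo len z :
  (lo <= z < lo + Z.of_nat len)%Z -> In z (Zrange lo len).
Proof.
  intro H. apply in_map_iff. exists (Z.to_nat (z - lo)).
  split; [lia|]. apply in_seq. lia.
Qed.

Lemma closed_rooms_covered :
  forallb (fun r =>
    forallb (fun cx => forallb (fun cy =>
      boundary_cell cx cy || existsb (open_room_cell cx cy) rooms)
      (Zrange (2 * snd (fst r)) (Z.to_nat (2 * (snd (snd r) - snd (fst r)) + 1))))
      (Zrange (2 * fst (fst r)) (Z.to_nat (2 * (fst (snd r) - fst (fst r)) + 1))))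
    rooms = true.
Proof. vm_compute. reflexivity. Qed.

Lemma inside_closure_off_boundary p :
  inside_closure p -> ~ on_boundary 22 gon22 p -> inside p.
Proof.
  intros Hp Hb. apply Exists_exists in Hp as [r [Hr [Ix Iy]]].
  destruct (cell_exists (fst p)) as [cx Hx], (cell_exists (snd p)) as [cy Hy].
  rewrite (on_boundary_cell p cx cy Hx Hy) in Hb.
  rewrite (cell_ge _ _ _ Hx), (cell_le _ _ _ Hx) in Ix.
  rewrite (cell_ge _ _ _ Hy), (cell_le _ _ _ Hy) in Iy.
  pose proof (proj1 (forallb_forall _ _) closed_rooms_covered r Hr) as H.
  cbv beta in H.
  pose proof (proj1 (forallb_forall _ _) H cx ltac:(apply Zrange_In; lia)) as H1.
  cbv beta in H1.
  pose proof (proj1 (forallb_forall _ _) H1 cy ltac:(apply Zrange_In; lia)) as H2.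
  cbv beta in H2. apply orb_true_iff in H2 as [H2|H2]; [easy|].
  apply existsb_exists in H2 as [r' [Hr' H2]].
  apply Exists_exists. exists r'. split; [exact Hr'|].
  unfold open_room_cell in H2. rewrite !andb_true_iff, !Z.ltb_lt in H2.
  unfold in_open_room.
  rewrite (cell_gt _ _ _ Hx), (cell_lt _ _ _ Hx), (cell_gt _ _ _ Hy), (cell_lt _ _ _ Hy).
  tauto.
Qed.

(** * Paths avoiding the boundary stay in the enclosed region *)

Definition along (a b : pt) (t : R) : pt := padd a (pscal t (psub b a)).

(** A common Lipschitz constant for both coordinates; the summand 1 keeps it positive when [a = b],
    so that it can be divided by. *)
Definition speed (a b : pt) : R :=
  Rabs (fst b - fst a) + Rabs (snd b - snd a) + 1.

Lemma speed_pos a b : 0 < speed a b.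
Proof.
  unfold speed.
  pose proof (Rabs_pos (fst b - fst a)); pose proof (Rabs_pos (snd b - snd a)); lra.
Qed.

Lemma along_lipschitz a b d t s :
  Rabs (s - t) < d / speed a b ->
  Rabs (fst (along a b s) - fst (along a b t)) < d /\
  Rabs (snd (along a b s) - snd (along a b t)) < d.
Proof.
  intro H. pose proof (speed_pos a b) as Hs.
  apply (Rmult_lt_compat_r (speed a b)) in H; [|exact Hs].
  replace (d / speed a b * speed a b) with d in H by (field; lra).
  cbn. unfold speed in H.
  pose proof (Rabs_pos (fst b - fst a)); pose proof (Rabs_pos (snd b - snd a)).
  pose proof (Rabs_pos (s - t)).
  split.
  - replace (fst a + s * (fst b - fst a) - (fst a + t * (fst b - fst a)))
      with ((s - t) * (fst b - fst a)) by ring.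
    rewrite Rabs_mult. nra.
  - replace (snd a + s * (snd b - snd a) - (snd a + t * (snd b - snd a)))
      with ((s - t) * (snd b - snd a)) by ring.
    rewrite Rabs_mult. nra.
Qed.

Lemma inside_open a b t :
  inside (along a b t) ->
  exists d, 0 < d /\ forall s, Rabs (s - t) < d -> inside (along a b s).
Proof.
  intro H. apply Exists_exists in H as [r [Hr [[A1 A2] [A3 A4]]]].
  set (p := along a b t) in *.
  set (m := Rmin (Rmin (fst p - IZR (fst (fst r))) (IZR (fst (snd r)) - fst p))
                 (Rmin (snd p - IZR (snd (fst r))) (IZR (snd (snd r)) - snd p))).
  assert (Hm : 0 < m) by (unfold m; repeat apply Rmin_glb_lt; lra).
  exists (m / speed a b). split; [apply Rdiv_lt_0_compat; [exact Hm|apply speed_pos]|].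
  intros s Hs. apply along_lipschitz in Hs as [Hx Hy]. fold p in Hx, Hy.
  apply Exists_exists. exists r. split; [exact Hr|].
  assert (m <= fst p - IZR (fst (fst r)) /\ m <= IZR (fst (snd r)) - fst p /\
          m <= snd p - IZR (snd (fst r)) /\ m <= IZR (snd (snd r)) - snd p).
  { unfold m. repeat split.
    - eapply Rle_trans; [apply Rmin_l|apply Rmin_l].
    - eapply Rle_trans; [apply Rmin_l|apply Rmin_r].
    - eapply Rle_trans; [apply Rmin_r|apply Rmin_l].
    - eapply Rle_trans; [apply Rmin_r|apply Rmin_r]. }
  apply Rabs_def2 in Hx; apply Rabs_def2 in Hy.
  unfold in_open_room. lra.
Qed.

Lemma outside_room_open r a b t :
  ~ in_closed_room r (along a b t) ->
  exists d, 0 < d /\ forall s, Rabs (s - t) < d -> ~ in_closed_room r (along a b s).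
Proof.
  intro H. set (p := along a b t) in *.
  assert (C : exists m, 0 < m /\
    (fst p + m <= IZR (fst (fst r)) \/ IZR (fst (snd r)) + m <= fst p \/
     snd p + m <= IZR (snd (fst r)) \/ IZR (snd (snd r)) + m <= snd p)).
  { destruct (Rle_lt_dec (IZR (fst (fst r))) (fst p)) as [A|A];
      [|exists (IZR (fst (fst r)) - fst p); lra].
    destruct (Rle_lt_dec (fst p) (IZR (fst (snd r)))) as [B|B];
      [|exists (fst p - IZR (fst (snd r))); lra].
    destruct (Rle_lt_dec (IZR (snd (fst r))) (snd p)) as [C|C];
      [|exists (IZR (snd (fst r)) - snd p); lra].
    destruct (Rle_lt_dec (snd p) (IZR (snd (snd r)))) as [D|D];
      [|exists (snd p - IZR (snd (snd r))); lra].
    exfalso. apply H. unfold in_closed_room. lra. }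
  destruct C as [m [Hm C]].
  exists (m / speed a b). split; [apply Rdiv_lt_0_compat; [exact Hm|apply speed_pos]|].
  intros s Hs [Ix Iy]. apply along_lipschitz in Hs as [Hx Hy]. fold p in Hx, Hy.
  apply Rabs_def2 in Hx; apply Rabs_def2 in Hy. lra.
Qed.

Lemma outside_rooms_open l a b t :
  ~ Exists (fun r => in_closed_room r (along a b t)) l ->
  exists d, 0 < d /\ forall s, Rabs (s - t) < d ->
    ~ Exists (fun r => in_closed_room r (along a b s)) l.
Proof.
  induction l as [|r l IH]; intro H.
  - exists 1. split; [lra|]. intros s _ E. now apply Exists_nil in E.
  - rewrite Exists_cons in H.
    destruct IH as [d1 [P1 H1]]; [tauto|].
    destruct (outside_room_open r a b t) as [d2 [P2 H2]]; [tauto|].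
    exists (Rmin d1 d2). split; [now apply Rmin_glb_lt|].
    intros s Hs. rewrite Exists_cons.
    assert (Rabs (s - t) < d1) by (eapply Rlt_le_trans; [exact Hs|apply Rmin_l]).
    assert (Rabs (s - t) < d2) by (eapply Rlt_le_trans; [exact Hs|apply Rmin_r]).
    intros [E|E]; [now apply (H2 s)|now apply (H1 s)].
Qed.

Lemma inside_in_closure p : inside p -> inside_closure p.
Proof.
  apply Exists_impl. intros r. unfold in_open_room, in_closed_room. lra.
Qed.

Lemma along_0 a b : along a b 0 = a.
Proof. destruct a; unfold along, padd, pscal; cbn; f_equal; ring. Qed.

Lemma along_1 a b : along a b 1 = b.
Proof. destruct a, b; unfold along, padd, pscal; cbn; f_equal; ring. Qed.

(** Connectedness of the segment: let T be the supremum of the times up to which it stays inside.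
    The point at T lies in the closure and off the boundary, hence inside, and openness would push
    past T unless T = 1. *)
Lemma seg_stays_inside a b :
  inside a -> seg_avoids 22 gon22 a b -> inside b.
Proof.
  intros Ha Hav.
  set (E := fun t => 0 <= t <= 1 /\ forall s, 0 <= s <= t -> inside (along a b s)).
  assert (E0 : E 0).
  { split; [lra|]. intros s Hs. replace s with 0 by lra. now rewrite along_0. }
  destruct (completeness E) as [T [Tub Tlub]].
  { exists 1. intros t [Ht _]. lra. }
  { now exists 0. }
  assert (T0 : 0 <= T) by now apply Tub.
  assert (T1 : T <= 1) by (apply Tlub; intros t [Ht _]; lra).
  assert (Hbelow : forall s, 0 <= s < T -> inside (along a b s)).
  { intros s Hs. apply NNPP. intro N.
    assert (T <= s); [|lra].
    apply Tlub. intros t [Ht Hin]. apply Rnot_lt_le. intro L.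
    apply N, Hin. lra. }
  assert (HT : inside (along a b T)).
  { apply inside_closure_off_boundary; [|apply Hav; exists T; split; [lra|reflexivity]].
    apply NNPP. intro N.
    destruct (outside_rooms_open rooms a b T N) as [d [Pd Hd]].
    destruct (Rle_lt_or_eq_dec 0 T T0) as [L|L].
    - set (s := Rmax 0 (T - d / 2)).
      assert (Hs : 0 <= s < T /\ T - d / 2 <= s).
      { unfold s, Rmax. destruct (Rle_dec 0 (T - d / 2)); lra. }
      apply (Hd s).
      + rewrite Rabs_left by lra. lra.
      + apply inside_in_closure, Hbelow. lra.
    - apply N. rewrite <- L, along_0. now apply inside_in_closure. }
  destruct (inside_open a b T HT) as [d [Pd Hd]].
  destruct (Rle_lt_or_eq_dec T 1 T1) as [L|L].
  - set (T' := Rmin 1 (T + d / 2)).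
    assert (HT' : T < T' <= 1 /\ T' <= T + d / 2).
    { unfold T', Rmin. destruct (Rle_dec 1 (T + d / 2)); lra. }
    assert (E T').
    { split; [lra|]. intros s Hs.
      destruct (Rlt_le_dec s T); [apply Hbelow; lra|].
      apply Hd. rewrite Rabs_right by lra. lra. }
    pose proof (Tub T' H). lra.
  - rewrite L, along_1 in HT. exact HT.
Qed.

Lemma path_stays_inside ms : forall p q,
  inside p -> path_avoids 22 gon22 p ms q -> inside q.
Proof.
  induction ms as [|m ms IH]; cbn; intros p q Hp H.
  - now apply (seg_stays_inside p).
  - destruct H as [H1 H2]. apply (IH m); [|exact H2].
    now apply (seg_stays_inside p).
Qed.

Lemma inside_bounded p : inside p -> norm2 p <= 100.
Proof.
  intro H. apply Exists_exists in H as [r [Hr [Hx Hy]]].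
  assert (B : -3 <= fst p <= 3 /\ -1 <= snd p <= 5).
  { cbn in Hr. repeat (destruct Hr as [<-|Hr]; [cbn in Hx, Hy; lra|]). easy. }
  unfold norm2, dot. nra.
Qed.

(** An exterior point could be joined to one of squared norm above 100, but such a path cannot leave
    the bounded enclosed region. *)
Lemma inside_in_interior p :
  inside p -> ~ on_boundary 22 gon22 p -> in_interior 22 gon22 p.
Proof.
  intros H Hb. split; [exact Hb|]. intro Hext.
  destruct (Hext 100) as [q [ms [Hq Hpath]]].
  pose proof (inside_bounded q (path_stays_inside ms p q H Hpath)). lra.
Qed.

Lemma source_interior : in_interior 22 gon22 (0, 0).
Proof.
  apply inside_in_interior.
  - apply Exists_exists. exists ((-1,-1),(1,1))%Z.
    split; [cbn; tauto|unfold in_open_room; cbn; lra].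
  - rewrite (on_boundary_cell (0, 0) _ _ (cell_IZR 0) (cell_IZR 0)). easy.
Qed.

Lemma target_interior : in_interior 22 gon22 (2, 2).
Proof.
  apply inside_in_interior.
  - apply Exists_exists. exists ((1,1),(3,3))%Z.
    split; [cbn; tauto|unfold in_open_room; cbn; lra].
  - rewrite (on_boundary_cell (2, 2) _ _ (cell_IZR 2) (cell_IZR 2)). easy.
Qed.

(** * Folding the polygon *)

(* The fifteen unit squares of the polygon, each with the number of the square
   of the staircase onto which it folds. *)
Definition tiles : list (Z * Z * nat) :=
  map (fun '(i, j, s) => (2 * i + 1, 2 * j + 1, s))%Z
    [(0,-1,1%nat); (0,0,2%nat); (1,0,3%nat); (1,1,4%nat); (2,1,5%nat);
     (-1,-1,1%nat); (-1,0,2%nat); (-2,0,3%nat); (-2,1,4%nat); (-3,1,5%nat);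
     (0,4,1%nat); (0,3,2%nat); (1,3,3%nat); (1,2,4%nat); (2,2,5%nat)]%Z.

Definition is_tile (cx cy : Z) (s : nat) : bool :=
  existsb (fun '(x, y, s') => Z.eqb x cx && Z.eqb y cy && Nat.eqb s' s)%bool tiles.

Lemma is_tile_In cx cy s : is_tile cx cy s = true <-> In (cx, cy, s) tiles.
Proof.
  unfold is_tile. rewrite existsb_exists. split.
  - intros [[[x y] s'] [H E]].
    rewrite !andb_true_iff, !Z.eqb_eq, Nat.eqb_eq in E.
    now destruct E as [[-> ->] ->].
  - intro H. exists (cx, cy, s). split; [exact H|].
    now rewrite !Z.eqb_refl, Nat.eqb_refl.
Qed.

(** Meant for even [c], where the cell is the integer [c / 2]. *)
Definition half_even (c : Z) : bool := Z.even (c / 2).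

Definition signs : list Z := [1; -1]%Z.

(** Compatibility of the numbering with the folded dynamics on the sides in direction (e, d): a wall
    sends the path back into the same tile, so the number must be kept; otherwise the tile across
    must carry the new number. *)
Definition at_side (cx cy : Z) (s : nat) (e d : Z) : bool :=
  let s' := cross_vertical (half_even (cx + e)) s in
  let s'' := cross_horizontal (half_even (cy + d)) s in
  (if boundary_cell (cx + e) cy then Nat.eqb s' s else is_tile (cx + 2 * e) cy s') &&
  (if boundary_cell cx (cy + d) then Nat.eqb s'' s else is_tile cx (cy + 2 * d) s'').

(** At a lattice point the path goes straight to the diagonal tile, or is reflected by a vertical or
    horizontal edge into one of the two adjacent tiles. At a vertex of the polygon it stops, and
    nothing is demanded. *)
Definition at_corner (cx cy : Z) (s : nat) (e d : Z) : bool :=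
  let px := (cx + e)%Z in
  let py := (cy + d)%Z in
  let s' := cross_corner (half_even px) (half_even py) s in
  (boundary_cell px py || is_tile (cx + 2 * e) (cy + 2 * d) s') &&
  forallb (fun g =>
    (negb (vertical_open g px py) || is_tile cx (cy + 2 * d) s') &&
    (negb (horizontal_open g px py) || is_tile (cx + 2 * e) cy s')) edges.

(** This finite check, over fifteen tiles and four diagonal directions, is what ties the polygon to
    the dynamics on five squares. *)
Lemma tiles_fold :
  forallb (fun '(cx, cy, s) => forallb (fun e => forallb (fun d =>
    at_side cx cy s e d && at_corner cx cy s e d) signs) signs) tiles = true.
Proof. vm_compute. reflexivity. Qed.

Definition is_sign (e : Z) : Prop := (e = 1 \/ e = -1)%Z.

Lemma tiles_fold_at cx cy s e d :
  In (cx, cy, s) tiles -> is_sign e -> is_sign d ->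
  at_side cx cy s e d = true /\ at_corner cx cy s e d = true.
Proof.
  intros Ht He Hd.
  pose proof (proj1 (forallb_forall _ _) tiles_fold _ Ht) as H. cbv beta iota in H.
  assert (Se : In e signs) by (destruct He as [-> | ->]; cbn; tauto).
  assert (Sd : In d signs) by (destruct Hd as [-> | ->]; cbn; tauto).
  pose proof (proj1 (forallb_forall _ _) H _ Se) as H1. cbv beta in H1.
  pose proof (proj1 (forallb_forall _ _) H1 _ Sd) as H2. cbv beta in H2.
  now apply andb_true_iff.
Qed.

Lemma tiles_odd cx cy s :
  In (cx, cy, s) tiles -> Z.odd cx = true /\ Z.odd cy = true.
Proof.
  intro H. cbn in H.
  repeat (destruct H as [[= <- <- <-]|H]; [easy|]). easy.
Qed.

(* Both ends of a unit of time of a coordinate [P / n] lie in the closed cell [c]. *)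
Definition spans (n P e c : Z) : Prop :=
  ((c - 1) * n <= 2 * P <= (c + 1) * n /\
   (c - 1) * n <= 2 * (P + e) <= (c + 1) * n)%Z.

(** Grid lines sit at multiples of n and the numerator moves by one unit, so it cannot jump over a
    line. Having landed on one, it may either go on into the next cell or turn back into [c]. *)
Lemma spans_next n P e c :
  (0 < n)%Z -> Z.odd c = true -> is_sign e -> spans n P e c ->
  let P' := (P + e)%Z in
  (P' = ((c + e) / 2) * n /\ spans n P' e (c + 2 * e) /\ spans n P' (- e) c)%Z \/
  ((c - 1) * n < 2 * P' < (c + 1) * n /\ spans n P' e c /\
    forall k, P' <> k * n)%Z.
Proof.
  intros Hn Hc He [H1 H2] P'.
  apply Z.odd_spec in Hc as [i ->].
  destruct (Z.eq_dec (2 * P') ((2 * i + 1 + e) * n)) as [E|E].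
  - left. destruct He as [-> | ->].
    + replace (2 * i + 1 + 1)%Z with ((i + 1) * 2)%Z in * by ring.
      rewrite Z.div_mul by easy. unfold spans, P' in *. repeat split; nia.
    + replace (2 * i + 1 + -1)%Z with (i * 2)%Z in * by ring.
      rewrite Z.div_mul by easy. unfold spans, P' in *. repeat split; nia.
  - right.
    assert (S : ((2 * i + 1 - 1) * n < 2 * P' < (2 * i + 1 + 1) * n)%Z).
    { unfold P' in *. destruct He as [-> | ->]; nia. }
    assert (F : forall k, P' <> (k * n)%Z).
    { intros k ->. destruct (Z.le_gt_cases k i); nia. }
    split; [exact S|split; [|exact F]].
    unfold spans, P' in *. destruct He as [-> | ->]; nia.
Qed.

Lemma cell_of_multiple (n P : Z) c e :
  (0 < n)%Z -> Z.odd c = true -> is_sign e ->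
  (P = (c + e) / 2 * n)%Z -> cell (IZR P / IZR n) (c + e).
Proof.
  intros Hn Hc He ->. apply Z.odd_spec in Hc as [i ->].
  left. exists ((2 * i + 1 + e) / 2)%Z. split.
  - destruct He as [-> | ->].
    + replace (2 * i + 1 + 1)%Z with ((i + 1) * 2)%Z by ring. rewrite Z.div_mul; lia.
    + replace (2 * i + 1 + -1)%Z with (i * 2)%Z by ring. rewrite Z.div_mul; lia.
  - rewrite mult_IZR. field. apply eq_IZR_contrapositive. lia.
Qed.

Lemma cell_of_between (n P : Z) c :
  (0 < n)%Z -> Z.odd c = true ->
  ((c - 1) * n < 2 * P < (c + 1) * n)%Z -> cell (IZR P / IZR n) c.
Proof.
  intros Hn Hc H. apply Z.odd_spec in Hc as [i ->].
  right. exists i. split; [reflexivity|].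
  assert (Hr : 0 < IZR n) by now apply IZR_lt.
  split; apply Rmult_lt_reg_r with (IZR n); try exact Hr.
  - replace (IZR P / IZR n * IZR n) with (IZR P) by (field; lra).
    rewrite <- mult_IZR. apply IZR_lt. lia.
  - replace (IZR P / IZR n * IZR n) with (IZR P) by (field; lra).
    rewrite <- mult_IZR. apply IZR_lt. lia.
Qed.

(* Numerator at time [u] of a coordinate that moves with velocity [e / n] and
   unfolds to the line through the origin. *)
Definition num (n : nat) (e k : Z) (u : nat) : Z :=
  (e * Z.of_nat u + 2 * k * Z.of_nat n)%Z.

Lemma num_S n e k u : num n e k (S u) = (num n e k u + e)%Z.
Proof. unfold num. lia. Qed.

(** Actual and unfolded coordinates differ by a sign and an even translation, which preserve
    integrality and parity. Events read off the unfolded line are therefore those of the actual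
    position. *)
Lemma num_multiple n e k u q :
  (n <> 0)%nat -> is_sign e -> num n e k u = (q * Z.of_nat n)%Z ->
  (u mod n = 0)%nat /\ Nat.even (u / n) = Z.even q.
Proof.
  intros Hn He H. unfold num in H.
  set (r := (e * (q - 2 * k))%Z).
  assert (Hr : (Z.of_nat u = r * Z.of_nat n)%Z)
    by (unfold r; destruct He as [-> | ->]; nia).
  assert (Hr0 : (0 <= r)%Z) by nia.
  assert (Hu : u = (Z.to_nat r * n)%nat) by nia.
  split.
  - apply Nat.Lcm0.mod_divide. now exists (Z.to_nat r).
  - rewrite Hu, Nat.div_mul by easy.
    assert (Ev : Z.even q = Z.even r).
    { unfold r. rewrite Z.even_mul, Z.even_sub, Z.even_mul.
      destruct He as [-> | ->]; cbn; destruct (Z.even q); easy. }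
    rewrite Ev. rewrite <- (Z2Nat.id r Hr0) at 2.
    clear. induction (Z.to_nat r) as [|a IH]; [easy|].
    rewrite Nat.even_succ, Nat2Z.inj_succ, Z.even_succ.
    rewrite <- Nat.negb_even, <- Z.negb_even. now rewrite IH.
Qed.

Lemma num_not_multiple n e k u :
  (n <> 0)%nat -> is_sign e -> (forall q, num n e k u <> (q * Z.of_nat n)%Z) ->
  (u mod n <> 0)%nat.
Proof.
  intros Hn He H E. apply Nat.Lcm0.mod_divide in E as [q ->].
  apply (H (e * Z.of_nat q + 2 * k)%Z). unfold num. lia.
Qed.

Lemma cell_unique x c c' : cell x c -> cell x c' -> c = c'.
Proof.
  intros H [[k [-> E]]|[k [-> [E1 E2]]]].
  - assert (A : IZR k <= x) by lra. apply (cell_ge _ _ _ H) in A.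
    assert (B : x <= IZR k) by lra. apply (cell_le _ _ _ H) in B. lia.
  - apply (cell_gt _ _ _ H) in E1. apply (cell_lt _ _ _ H) in E2. lia.
Qed.

Lemma vertical_open_boundary g px py :
  In g edges -> vertical_open g px py = true -> boundary_cell px py = true.
Proof.
  intros Hg H. apply existsb_exists. exists g. split; [exact Hg|].
  destruct g as [[x1 y1] [x2 y2]]; cbn -[Z.mul] in *.
  rewrite !andb_true_iff, !Z.leb_le, ?Z.ltb_lt, ?Z.eqb_eq in *. lia.
Qed.

Lemma horizontal_open_boundary g px py :
  In g edges -> horizontal_open g px py = true -> boundary_cell px py = true.
Proof.
  intros Hg H. apply existsb_exists. exists g. split; [exact Hg|].
  destruct g as [[x1 y1] [x2 y2]]; cbn -[Z.mul] in *.
  rewrite !andb_true_iff, !Z.leb_le, ?Z.ltb_lt, ?Z.eqb_eq in *. lia.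
Qed.

Lemma vertical_open_even g px py : vertical_open g px py = true -> Z.odd px = false.
Proof.
  destruct g as [[x1 y1] [x2 y2]]; cbn -[Z.mul].
  rewrite !andb_true_iff, !Z.eqb_eq. intros [[[_ ->] _] _].
  now rewrite Z.odd_mul.
Qed.

Lemma horizontal_open_even g px py : horizontal_open g px py = true -> Z.odd py = false.
Proof.
  destruct g as [[x1 y1] [x2 y2]]; cbn -[Z.mul].
  rewrite !andb_true_iff, !Z.eqb_eq. intros [[[_ ->] _] _].
  now rewrite Z.odd_mul.
Qed.

(** * Following the tile number along the unfolded line *)

Section Tracking.
Variables n m s0 : nat.
Hypothesis n_pos : n <> 0%nat.
Hypothesis m_pos : m <> 0%nat.

Definition position (e k d l : Z) (u : nat) : pt :=
  (IZR (num n e k u) / IZR (Z.of_nat n), IZR (num m d l u) / IZR (Z.of_nat m)).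

(** The invariant: from time u to u + 1, motion with signs [e] and [d] runs in a tile bearing the
    number that the itinerary predicts. *)
Definition tracked (e k d l : Z) (u : nat) : Prop :=
  exists cx cy, In (cx, cy, itinerary n m s0 u) tiles /\
    spans (Z.of_nat n) (num n e k u) e cx /\ spans (Z.of_nat m) (num m d l u) d cy.

(** The first conclusion serves points where the path passes freely, the second points where it is
    reflected: a vertical edge flips [e], a horizontal one [d], and the translation changes so that
    the position at [S u] is the same. *)
Lemma tracked_next e k d l u :
  is_sign e -> is_sign d -> tracked e k d l u ->
  (~ on_boundary 22 gon22 (position e k d l (S u)) -> tracked e k d l (S u)) /\
  (forall g px py, In g edges ->
     cell (fst (position e k d l (S u))) px -> cell (snd (position e k d l (S u))) py ->
     (vertical_open g px py = true ->
        forall k', num n (- e) k' (S u) = num n e k (S u) -> tracked (- e) k' d l (S u)) /\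
     (horizontal_open g px py = true ->
        forall l', num m (- d) l' (S u) = num m d l (S u) -> tracked e k (- d) l' (S u))).
Proof.
  intros He Hd [cx [cy [Ht [Sx Sy]]]].
  destruct (tiles_odd _ _ _ Ht) as [Ox Oy].
  destruct (tiles_fold_at _ _ _ e d Ht He Hd) as [Hside Hcorner].
  assert (Pn : (0 < Z.of_nat n)%Z) by lia.
  assert (Pm : (0 < Z.of_nat m)%Z) by lia.
  unfold position; cbn [fst snd].
  set (s := itinerary n m s0 u) in *.
  assert (Hs : itinerary n m s0 (S u) = event n m (S u) s) by reflexivity.
  unfold at_side in Hside. cbv zeta in Hside.
  unfold at_corner in Hcorner. cbv zeta in Hcorner.
  rewrite andb_true_iff in Hside, Hcorner.
  destruct Hside as [Vside Hside], Hcorner as [Cstraight Copen].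
  rewrite forallb_forall in Copen.
  unfold event in Hs.
  (* Four cases for time [S u]: a lattice point, a vertical grid line only, a horizontal one only,
     or no grid line. *)
  destruct (spans_next _ _ _ _ Pn Ox He Sx) as [[Mx [Fx Bx]]|[Mx [Fx Nx]]];
  destruct (spans_next _ _ _ _ Pm Oy Hd Sy) as [[My [Fy By]]|[My [Fy Ny]]];
  rewrite <- num_S in *.
  - destruct (num_multiple _ _ _ _ _ n_pos He Mx) as [Zx Ex].
    destruct (num_multiple _ _ _ _ _ m_pos Hd My) as [Zy Ey].
    pose proof (cell_of_multiple _ _ _ _ Pn Ox He Mx) as Cx.
    pose proof (cell_of_multiple _ _ _ _ Pm Oy Hd My) as Cy.
    rewrite Zx, Zy, Ex, Ey in Hs. cbn [Nat.eqb] in Hs.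
    split.
    + intro Hb. rewrite (on_boundary_cell (_, _) _ _ Cx Cy) in Hb.
      apply orb_true_iff in Cstraight as [C|C]; [easy|].
      apply is_tile_In in C.
      exists (cx + 2 * e)%Z, (cy + 2 * d)%Z. rewrite Hs. tauto.
    + intros g px py Hg Hpx Hpy.
      rewrite (cell_unique _ _ _ Hpx Cx), (cell_unique _ _ _ Hpy Cy).
      specialize (Copen g Hg). cbv beta in Copen.
      rewrite andb_true_iff, !orb_true_iff, !negb_true_iff in Copen.
      destruct Copen as [Cv Ch]. split; intros Ho k' Hk'.
      * destruct Cv as [Cv|Cv]; [congruence|]. apply is_tile_In in Cv.
        exists cx, (cy + 2 * d)%Z. rewrite Hs, Hk'. tauto.
      * destruct Ch as [Ch|Ch]; [congruence|]. apply is_tile_In in Ch.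
        exists (cx + 2 * e)%Z, cy. rewrite Hs, Hk'. tauto.
  - destruct (num_multiple _ _ _ _ _ n_pos He Mx) as [Zx Ex].
    pose proof (num_not_multiple _ _ _ _ m_pos Hd Ny) as Zy.
    apply Nat.eqb_neq in Zy.
    pose proof (cell_of_multiple _ _ _ _ Pn Ox He Mx) as Cx.
    pose proof (cell_of_between _ _ _ Pm Oy My) as Cy.
    rewrite Zx, Zy, Ex in Hs. cbn [Nat.eqb] in Hs.
    split.
    + intro Hb. rewrite (on_boundary_cell (_, _) _ _ Cx Cy) in Hb.
      apply not_true_is_false in Hb. rewrite Hb in Vside. apply is_tile_In in Vside.
      exists (cx + 2 * e)%Z, cy. rewrite Hs. tauto.
    + intros g px py Hg Hpx Hpy.
      rewrite (cell_unique _ _ _ Hpx Cx), (cell_unique _ _ _ Hpy Cy).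
      split; intros Ho k' Hk'.
      * rewrite (vertical_open_boundary _ _ _ Hg Ho) in Vside.
        apply Nat.eqb_eq in Vside.
        exists cx, cy. rewrite Hs, Hk'. unfold half_even in Vside. rewrite Vside. tauto.
      * apply horizontal_open_even in Ho. congruence.
  - destruct (num_multiple _ _ _ _ _ m_pos Hd My) as [Zy Ey].
    pose proof (num_not_multiple _ _ _ _ n_pos He Nx) as Zx.
    apply Nat.eqb_neq in Zx.
    pose proof (cell_of_between _ _ _ Pn Ox Mx) as Cx.
    pose proof (cell_of_multiple _ _ _ _ Pm Oy Hd My) as Cy.
    rewrite Zx, Zy, Ey in Hs. cbn [Nat.eqb] in Hs.
    split.
    + intro Hb. rewrite (on_boundary_cell (_, _) _ _ Cx Cy) in Hb.
      apply not_true_is_false in Hb. rewrite Hb in Hside. apply is_tile_In in Hside.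
      exists cx, (cy + 2 * d)%Z. rewrite Hs. tauto.
    + intros g px py Hg Hpx Hpy.
      rewrite (cell_unique _ _ _ Hpx Cx), (cell_unique _ _ _ Hpy Cy).
      split; intros Ho k' Hk'.
      * apply vertical_open_even in Ho. congruence.
      * rewrite (horizontal_open_boundary _ _ _ Hg Ho) in Hside.
        apply Nat.eqb_eq in Hside.
        exists cx, cy. rewrite Hs, Hk'. unfold half_even in Hside. rewrite Hside. tauto.
  - pose proof (num_not_multiple _ _ _ _ n_pos He Nx) as Zx.
    pose proof (num_not_multiple _ _ _ _ m_pos Hd Ny) as Zy.
    apply Nat.eqb_neq in Zx. apply Nat.eqb_neq in Zy.
    pose proof (cell_of_between _ _ _ Pn Ox Mx) as Cx.
    pose proof (cell_of_between _ _ _ Pm Oy My) as Cy.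
    rewrite Zx, Zy in Hs.
    split.
    + intros _. exists cx, cy. rewrite Hs. tauto.
    + intros g px py Hg Hpx Hpy.
      rewrite (cell_unique _ _ _ Hpx Cx), (cell_unique _ _ _ Hpy Cy).
      split; intros Ho k' Hk'.
      * apply vertical_open_even in Ho. congruence.
      * apply horizontal_open_even in Ho. congruence.
Qed.

(* The four squares around [(2, 2)] fold to the fourth and fifth squares. *)
Lemma tracked_target e k d l u :
  is_sign e -> is_sign d -> home s0 -> tracked e k d l u ->
  num n e k (S u) = (2 * Z.of_nat n)%Z -> num m d l (S u) = (2 * Z.of_nat m)%Z -> False.
Proof.
  intros He Hd H0 [cx [cy [Ht [Sx Sy]]]] Ex Ey.
  (* In doubled coordinates 3 and 5 are the unit intervals on either side of 2. *)
  assert (Hx : cx = 3%Z \/ cx = 5%Z).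
  { destruct (tiles_odd _ _ _ Ht) as [Ox _]. apply Z.odd_spec in Ox as [i ->].
    unfold spans in Sx. rewrite <- num_S, Ex in Sx.
    destruct (Z.eq_dec i 1); [lia|]. destruct (Z.eq_dec i 2); [lia|]. nia. }
  assert (Hy : cy = 3%Z \/ cy = 5%Z).
  { destruct (tiles_odd _ _ _ Ht) as [_ Oy]. apply Z.odd_spec in Oy as [i ->].
    unfold spans in Sy. rewrite <- num_S, Ey in Sy.
    destruct (Z.eq_dec i 1); [lia|]. destruct (Z.eq_dec i 2); [lia|]. nia. }
  destruct (num_multiple _ _ _ _ _ n_pos He Ex) as [Zx Evx].
  destruct (num_multiple _ _ _ _ _ m_pos Hd Ey) as [Zy Evy].
  apply Nat.even_spec in Evx as [a Ha]. apply Nat.even_spec in Evy as [b Hb].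
  pose proof (Nat.div_mod_eq (S u) n) as Dn. pose proof (Nat.div_mod_eq (S u) m) as Dm.
  (* Arrival at [S u] is at an even-even point, and the tile before it has index [u]; no tile around
     (2,2) is numbered 1 or 2. *)
  assert (Hh : home (itinerary n m s0 (S u - 1))).
  { apply (home_before_even_point n m s0 n_pos m_pos a b (S u) H0); nia. }
  replace (S u - 1)%nat with u in Hh by lia.
  apply is_tile_In in Ht.
  destruct Hh as [Hh|Hh]; rewrite Hh in Ht;
    destruct Hx as [-> | ->], Hy as [-> | ->]; vm_compute in Ht; discriminate.
Qed.

End Tracking.

(** * Trajectories *)

(** The line (al t, be t) through the origin, folded by x -> e x + 2k and y -> d y + 2l with signs e
    and d. *)
Definition at_time (al be : R) (e k d l : Z) (t : R) (p : pt) : Prop :=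
  fst p = IZR e * al * t + 2 * IZR k /\ snd p = IZR d * be * t + 2 * IZR l.

(** For an axis-parallel edge [reflect_vec] merely negates the component normal to the edge. The
    factor [r] compares the lengths of the two segments. *)
Lemma reflects_cases a p b :
  reflects 22 gon22 a p b ->
  exists g r, In g edges /\ 0 < r /\
  ((exists c, fst p = IZR c /\
      (forall px py, cell (fst p) px -> cell (snd p) py -> vertical_open g px py = true) /\
      fst b - fst p = - r * (fst p - fst a) /\ snd b - snd p = r * (snd p - snd a)) \/
   (exists c, snd p = IZR c /\
      (forall px py, cell (fst p) px -> cell (snd p) py -> horizontal_open g px py = true) /\
      fst b - fst p = r * (fst p - fst a) /\ snd b - snd p = - r * (snd p - snd a))).
Proof.
  intros [i [Hi [[t [Ht Ep]] [r [Hr E]]]]].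
  exists (edge i), r. split; [now apply edge_In|]. split; [exact Hr|].
  rewrite !vtx_gon22 in Ep, E.
  pose proof (edge_parallel i Hi) as Hpar. unfold edge in *.
  destruct (corner (i mod 22)) as [x1 y1], (corner (S i mod 22)) as [x2 y2].
  cbn in Hpar. unfold padd, psub, pscal, reflect_vec, dot, embed in *. cbn in Ep, E.
  destruct a as [ax ay], b as [bx by_].
  rewrite Ep in E |- *. cbn [fst snd] in E |- *. injection E as Ex Ey.
  destruct (Z.eqb_spec x1 x2) as [F|F], (Z.eqb_spec y1 y2) as [G|G]; try easy.
  - subst x2. left. exists x1.
    assert (N : IZR y1 <> IZR y2) by now apply eq_IZR_contrapositive.
    pose proof (param_strictly_between _ _ t Ht N) as Bt.
    rewrite Rmin_IZR, Rmax_IZR in Bt.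
    split; [ring|split; [|split]].
    + intros px py Hx Hy.
      replace (IZR x1 + t * (IZR x1 - IZR x1)) with (IZR x1) in Hx by ring.
      rewrite (cell_unique _ _ _ Hx (cell_IZR x1)).
      cbv beta iota delta [vertical_open]. rewrite !Z.eqb_refl. cbn [andb].
      rewrite andb_true_iff, !Z.ltb_lt.
      rewrite <- (cell_gt _ _ _ Hy), <- (cell_lt _ _ _ Hy). exact Bt.
    + rewrite Ex. field. intro Z0. nra.
    + rewrite Ey. field. intro Z0. nra.
  - subst y2. right. exists y1.
    assert (N : IZR x1 <> IZR x2) by now apply eq_IZR_contrapositive.
    pose proof (param_strictly_between _ _ t Ht N) as Bt.
    rewrite Rmin_IZR, Rmax_IZR in Bt.
    split; [ring|split; [|split]].
    + intros px py Hx Hy.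
      replace (IZR y1 + t * (IZR y1 - IZR y1)) with (IZR y1) in Hy by ring.
      rewrite (cell_unique _ _ _ Hy (cell_IZR y1)).
      cbv beta iota delta [horizontal_open]. rewrite !Z.eqb_refl. cbn [andb].
      rewrite andb_true_iff, !Z.ltb_lt.
      rewrite <- (cell_gt _ _ _ Hx), <- (cell_lt _ _ _ Hx). exact Bt.
    + rewrite Ex. field. intro Z0. nra.
    + rewrite Ey. field. intro Z0. nra.
Qed.

Lemma reflects_at_time al be e k d l t0 t1 a p b :
  t0 < t1 -> at_time al be e k d l t0 a -> at_time al be e k d l t1 p ->
  reflects 22 gon22 a p b ->
  exists g t2, In g edges /\ t1 < t2 /\
  ((exists c k', fst p = IZR c /\
      (forall px py, cell (fst p) px -> cell (snd p) py -> vertical_open g px py = true) /\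
      at_time al be (- e) k' d l t1 p /\ at_time al be (- e) k' d l t2 b) \/
   (exists c l', snd p = IZR c /\
      (forall px py, cell (fst p) px -> cell (snd p) py -> horizontal_open g px py = true) /\
      at_time al be e k (- d) l' t1 p /\ at_time al be e k (- d) l' t2 b)).
Proof.
  intros Ht [Ax Ay] [Px Py] H.
  destruct (reflects_cases a p b H) as [g [r [Hg [Hr H']]]].
  (* The new segment is [r] times as long as the old one and is run through at the same speed. *)
  exists g, (t1 + r * (t1 - t0)). split; [exact Hg|]. split; [nra|].
  destruct H' as [[c [Hc [Ho [Bx By]]]]|[c [Hc [Ho [Bx By]]]]].
  (* Reflection in x = c sends x to 2c - x, so e becomes -e and 2k becomes 2(c - k). *)
  - left. exists c, (c - k)%Z. split; [exact Hc|]. split; [exact Ho|].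
    unfold at_time. rewrite opp_IZR, minus_IZR. repeat split; nra.
  - right. exists c, (c - l)%Z. split; [exact Hc|]. split; [exact Ho|].
    unfold at_time. rewrite opp_IZR, minus_IZR. repeat split; nra.
Qed.

Lemma last_cons {A} (s : list A) : forall b p, last (b :: s) p = last s b.
Proof.
  induction s as [|c s IH]; intros b p; [reflexivity|].
  change (last (b :: c :: s) p) with (last (c :: s) p).
  now rewrite !IH.
Qed.

Lemma is_sign_opp e : is_sign e -> is_sign (- e).
Proof. unfold is_sign. lia. Qed.

(** Stated for arbitrary real speeds: its equations at the target force the ratio of the speeds to
    be rational, which the discrete itinerary presupposes. *)
Lemma trajectory_end_unfolds al be : forall (s : list pt) (a p : pt) e k d l t0 t1,
  t0 < t1 -> is_sign e -> is_sign d ->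
  at_time al be e k d l t0 a -> at_time al be e k d l t1 p ->
  refls_ok 22 gon22 (a :: p :: s) ->
  exists e' k' d' l' T, is_sign e' /\ is_sign d' /\ t1 <= T /\
    at_time al be e' k' d' l' T (last s p).
Proof.
  induction s as [|b s IH]; intros a p e k d l t0 t1 Ht He Hd Ha Hp Hr.
  - exists e, k, d, l, t1. repeat split; try tauto; try apply Hp. lra.
  - destruct Hr as [Hr Hrs].
    destruct (reflects_at_time _ _ _ _ _ _ _ _ _ _ _ Ht Ha Hp Hr)
      as [g [t2 [_ [Ht2 [[c [k' [_ [_ [Hp' Hb]]]]]|[c [l' [_ [_ [Hp' Hb]]]]]]]]]].
    + destruct (IH p b (- e)%Z k' d l t1 t2 Ht2 (is_sign_opp e He) Hd Hp' Hb Hrs)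
        as [e' [k1 [d' [l1 [T [H1 [H2 [H3 H4]]]]]]]].
      exists e', k1, d', l1, T. rewrite last_cons. repeat split; try tauto; try apply H4. lra.
    + destruct (IH p b e k (- d)%Z l' t1 t2 Ht2 He (is_sign_opp d Hd) Hp' Hb Hrs)
        as [e' [k1 [d' [l1 [T [H1 [H2 [H3 H4]]]]]]]].
      exists e', k1, d', l1, T. rewrite last_cons. repeat split; try tauto; try apply H4. lra.
Qed.

(** Each reflection multiplies the horizontal displacement by r or -r, so it remains zero. *)
Lemma vertical_trajectory : forall (s : list pt) (a p : pt),
  fst a = fst p -> refls_ok 22 gon22 (a :: p :: s) -> fst (last s p) = fst p.
Proof.
  induction s as [|b s IH]; intros a p E Hr; [reflexivity|].
  destruct Hr as [Hr Hrs]. rewrite last_cons.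
  destruct (reflects_cases a p b Hr) as [g [r [_ [_ H]]]].
  assert (F : fst p = fst b) by (destruct H as [[c H]|[c H]]; nra).
  now rewrite (IH p b F Hrs).
Qed.

Lemma horizontal_trajectory : forall (s : list pt) (a p : pt),
  snd a = snd p -> refls_ok 22 gon22 (a :: p :: s) -> snd (last s p) = snd p.
Proof.
  induction s as [|b s IH]; intros a p E Hr; [reflexivity|].
  destruct Hr as [Hr Hrs]. rewrite last_cons.
  destruct (reflects_cases a p b Hr) as [g [r [_ [_ H]]]].
  assert (F : snd p = snd b) by (destruct H as [[c H]|[c H]]; nra).
  now rewrite (IH p b F Hrs).
Qed.

(** * Rational directions and integer crossing times *)

Lemma num_coordinate n e k u :
  n <> 0%nat ->
  IZR (num n e k u) / IZR (Z.of_nat n) = IZR e * / INR n * INR u + 2 * IZR k.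
Proof.
  intro Hn. unfold num. rewrite plus_IZR, !mult_IZR, <- !INR_IZR_INZ.
  field. now apply not_0_INR.
Qed.

Lemma num_of_coordinate n e k u c :
  n <> 0%nat -> IZR e * / INR n * INR u + 2 * IZR k = IZR c ->
  num n e k u = (c * Z.of_nat n)%Z.
Proof.
  intros Hn H. apply eq_IZR. rewrite <- num_coordinate in H by exact Hn.
  rewrite mult_IZR, <- H. field.
  apply eq_IZR_contrapositive. lia.
Qed.

(** Solving for t gives e (c - 2k) n, an integer; so reflections happen only at the time steps of
    the itinerary. *)
Lemma crossing_time_integral n e k c t :
  n <> 0%nat -> is_sign e -> 0 <= t ->
  IZR e * / INR n * t + 2 * IZR k = IZR c -> exists u, t = INR u.
Proof.
  intros Hn He Ht H.
  set (z := (e * (c - 2 * k) * Z.of_nat n)%Z).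
  assert (E : t = IZR z).
  { unfold z. rewrite !mult_IZR, minus_IZR, mult_IZR, <- H, <- INR_IZR_INZ.
    assert (INR n <> 0) by now apply not_0_INR.
    destruct He as [-> | ->]; field; assumption. }
  exists (Z.to_nat z). rewrite INR_IZR_INZ, Z2Nat.id; [exact E|].
  apply le_IZR. lra.
Qed.

Section Trajectory.
Variables n m s0 : nat.
Hypothesis n_pos : n <> 0%nat.
Hypothesis m_pos : m <> 0%nat.
Hypothesis s0_home : home s0.

Let moves := at_time (/ INR n) (/ INR m).

Lemma position_at_time e k d l u p :
  moves e k d l (INR u) p -> p = position n m e k d l u.
Proof.
  intros [Hx Hy]. unfold position. rewrite !num_coordinate by assumption.
  destruct p; cbn in *. now f_equal.
Qed.

(** The open segment lies in the interior of the polygon, so at each integer time before its end the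
    path passes freely. *)
Lemma tracked_along_segment e k d l u0 t1 a p :
  is_sign e -> is_sign d -> INR u0 < t1 ->
  moves e k d l (INR u0) a -> moves e k d l t1 p ->
  good_seg 22 gon22 a p -> tracked n m s0 e k d l u0 ->
  forall j, INR (u0 + j) < t1 -> tracked n m s0 e k d l (u0 + j).
Proof.
  intros He Hd Ht [Ax Ay] [Px Py] [_ Hgood] H0.
  induction j as [|j IH]; intro Hj; [now rewrite Nat.add_0_r|].
  rewrite Nat.add_succ_r in *.
  assert (Hlt : INR (u0 + j) < INR (S (u0 + j))) by (apply lt_INR; lia).
  destruct (tracked_next n m s0 n_pos m_pos e k d l (u0 + j) He Hd) as [H _];
    [apply IH; lra|].
  apply H. apply Hgood.
  assert (Hu : INR u0 < INR (S (u0 + j))) by (apply lt_INR; lia).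
  (* The motion is uniform, so the segment parameter is the fraction of time elapsed. *)
  exists ((INR (S (u0 + j)) - INR u0) / (t1 - INR u0)). split.
  - split; [apply Rdiv_lt_0_compat; lra|].
    apply Rmult_lt_reg_r with (t1 - INR u0); [lra|]. unfold Rdiv.
    rewrite Rmult_assoc, Rinv_l by lra. lra.
  - unfold position. rewrite !num_coordinate by assumption.
    unfold padd, pscal, psub; cbn [fst snd].
    rewrite Ax, Ay, Px, Py.
    assert (INR n <> 0) by now apply not_0_INR.
    assert (INR m <> 0) by now apply not_0_INR.
    f_equal; field; repeat split; try assumption; lra.
Qed.

Lemma tracked_misses_target : forall (s : list pt) (a p : pt) e k d l u0 t1,
  is_sign e -> is_sign d -> INR u0 < t1 ->
  moves e k d l (INR u0) a -> moves e k d l t1 p ->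
  tracked n m s0 e k d l u0 ->
  segs_ok 22 gon22 (a :: p :: s) -> refls_ok 22 gon22 (a :: p :: s) ->
  last s p <> (2, 2).
Proof.
  (* A segment ending on a grid line ends at an integer time [S u], and tracking reaches the step
     [u] just before. This covers both reflection points and the target. *)
  assert (Hlast : forall e k d l u0 t1 a p, is_sign e -> is_sign d -> INR u0 < t1 ->
    moves e k d l (INR u0) a -> moves e k d l t1 p -> tracked n m s0 e k d l u0 ->
    good_seg 22 gon22 a p ->
    ((exists c, fst p = IZR c) \/ (exists c, snd p = IZR c)) ->
    exists u, t1 = INR (S u) /\ tracked n m s0 e k d l u).
  { intros e k d l u0 t1 a p He Hd Ht Ha Hp H0 Hg Hc.
    assert (Hu : exists u, t1 = INR u).
    { pose proof (pos_INR u0). destruct Hp as [Px Py].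
      destruct Hc as [[c Hc]|[c Hc]].
      - rewrite Hc in Px. symmetry in Px.
        apply (crossing_time_integral n e k c); auto; lra.
      - rewrite Hc in Py. symmetry in Py.
        apply (crossing_time_integral m d l c); auto; lra. }
    destruct Hu as [u ->]. apply INR_lt in Ht as Hlt.
    destruct u as [|u]; [lia|].
    exists u. split; [reflexivity|].
    replace u with (u0 + (u - u0))%nat by lia.
    apply (tracked_along_segment e k d l u0 (INR (S u)) a p); auto.
    apply lt_INR. lia. }
  induction s as [|b s IH]; intros a p e k d l u0 t1 He Hd Ht Ha Hp H0 Hs Hr.
  - cbn. intros ->.
    destruct Hs as [Hg _].
    destruct (Hlast e k d l u0 t1 a (2, 2) He Hd Ht Ha Hp H0 Hg) as [u [-> Hu]].
    { left. now exists 2%Z. }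
    destruct Hp as [Px Py]; cbn [fst snd] in Px, Py.
    apply (tracked_target n m s0 n_pos m_pos e k d l u He Hd s0_home Hu).
    + apply num_of_coordinate; [exact n_pos|now symmetry].
    + apply num_of_coordinate; [exact m_pos|now symmetry].
  - rewrite last_cons.
    destruct Hs as [Hg Hs], Hr as [Hr Hrs].
    destruct (reflects_at_time _ _ _ _ _ _ _ _ _ _ _ Ht Ha Hp Hr)
      as [g [t2 [Hge [Ht2 Hcases]]]].
    destruct (Hlast e k d l u0 t1 a p He Hd Ht Ha Hp H0 Hg) as [u [-> Hu]].
    { destruct Hcases as [[c [k' [Hc _]]]|[c [l' [Hc _]]]]; [left|right]; now exists c. }
    destruct (tracked_next n m s0 n_pos m_pos e k d l u He Hd Hu) as [_ Hnext].
    rewrite <- (position_at_time _ _ _ _ _ _ Hp) in Hnext.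
    destruct (cell_exists (fst p)) as [cx Hx], (cell_exists (snd p)) as [cy Hy].
    specialize (Hnext g cx cy Hge Hx Hy).
    pose proof (position_at_time _ _ _ _ _ _ Hp) as Epos.
    destruct Hcases as [[c [k' [Hc [Ho [Hp' Hb]]]]]|[c [l' [Hc [Ho [Hp' Hb]]]]]].
    + apply (IH p b (- e)%Z k' d l (S u) t2); auto using is_sign_opp.
      apply (proj1 Hnext (Ho cx cy Hx Hy)).
      (* The motions before and after the reflection both put [p] at the integer abscissa [c]. *)
      transitivity (c * Z.of_nat n)%Z; [|symmetry];
        apply num_of_coordinate; try exact n_pos; rewrite <- Hc; symmetry;
        [apply Hp'|apply Hp].
    + apply (IH p b e k (- d)%Z l' (S u) t2); auto using is_sign_opp.
      apply (proj2 Hnext (Ho cx cy Hx Hy)).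
      transitivity (c * Z.of_nat m)%Z; [|symmetry];
        apply num_of_coordinate; try exact m_pos; rewrite <- Hc; symmetry;
        [apply Hp'|apply Hp].
Qed.

End Trajectory.

Lemma tracked_start n m e d :
  n <> 0%nat -> m <> 0%nat -> is_sign e -> is_sign d ->
  exists s0, home s0 /\ tracked n m s0 e 0 d 0 0.
Proof.
  intros Hn Hm He Hd.
  (* Upward motion starts in a tile numbered 2, downward motion in one numbered 1; in doubled
     coordinates that tile is the cell (e, d). *)
  exists (if Z.eqb d 1 then 2%nat else 1%nat). split.
  - destruct Hd as [-> | ->]; unfold home; cbn; tauto.
  - exists e, d. split; [|unfold spans, num].
    + cbn [itinerary]. apply is_tile_In.
      destruct He as [-> | ->], Hd as [-> | ->]; reflexivity.
    + destruct He as [-> | ->], Hd as [-> | ->]; lia.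
Qed.

Lemma sign_abs x : x <> 0 -> exists e, is_sign e /\ x = IZR e * Rabs x.
Proof.
  intro H. destruct (Rle_lt_dec 0 x).
  - exists 1%Z. split; [now left|]. rewrite Rabs_right; lra.
  - exists (-1)%Z. split; [now right|]. rewrite Rabs_left; lra.
Qed.

Lemma even_period al e k T :
  0 < al -> 0 < T -> is_sign e -> 2 = IZR e * al * T + 2 * IZR k ->
  exists i, i <> 0%nat /\ al * T = 2 * INR i.
Proof.
  intros Hal HT He H.
  set (z := (e * (1 - k))%Z).
  assert (E : al * T = 2 * IZR z).
  { unfold z. rewrite mult_IZR, minus_IZR.
    destruct He as [-> | ->]; lra. }
  assert (Hz : (0 < z)%Z) by (apply lt_IZR; nra).
  exists (Z.to_nat z). split; [lia|].
  rewrite INR_IZR_INZ, Z2Nat.id by lia. exact E.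
Qed.

Lemma trajectory_misses_target (p : pt) (s : list pt) :
  segs_ok 22 gon22 ((0, 0) :: p :: s) -> refls_ok 22 gon22 ((0, 0) :: p :: s) ->
  last s p <> (2, 2).
Proof.
  intros Hs Hr E.
  (* Axis-parallel starts keep a coordinate equal to 0 and so miss (2,2); otherwise both speeds are
     positive. *)
  destruct (Req_dec (fst p) 0) as [X|X].
  { assert (F : fst (last s p) = fst p)
      by (apply (vertical_trajectory s (0, 0)); [now symmetry|exact Hr]).
    rewrite E, X in F. cbn in F. lra. }
  destruct (Req_dec (snd p) 0) as [Y|Y].
  { assert (F : snd (last s p) = snd p)
      by (apply (horizontal_trajectory s (0, 0)); [now symmetry|exact Hr]).
    rewrite E, Y in F. cbn in F. lra. }
  destruct (sign_abs _ X) as [e [He Ex]], (sign_abs _ Y) as [d [Hd Ey]].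
  pose proof (Rabs_pos_lt _ X) as Px. pose proof (Rabs_pos_lt _ Y) as Py.
  set (al := Rabs (fst p)) in *. set (be := Rabs (snd p)) in *.
  (* Time is first normalised so that [p] is reached at time 1. *)
  destruct (trajectory_end_unfolds al be s (0, 0) p e 0 d 0 0 1)
    as [e' [k' [d' [l' [T [He' [Hd' [HT [Tx Ty]]]]]]]]]; auto; try lra.
  { split; cbn; ring. }
  { split; cbn; lra. }
  rewrite E in Tx, Ty. cbn [fst snd] in Tx, Ty.
  destruct (even_period al e' k' T) as [i [Hi Ai]]; auto; try lra.
  destruct (even_period be d' l' T) as [j [Hj Bj]]; auto; try lra.
  (* From al T = 2i and be T = 2j the speeds are in the ratio of 1/j to 1/i, whence n = j and m = i.
     In the rescaled time [p] is reached at j al, which equals i be. *)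
  destruct (tracked_start j i e d Hj Hi He Hd) as [s0 [Hs0 Htr]].
  assert (Ni : 0 < INR i) by (apply lt_0_INR; lia).
  assert (Nj : 0 < INR j) by (apply lt_0_INR; lia).
  apply (tracked_misses_target j i s0 Hj Hi Hs0 s (0, 0) p e 0 d 0 0 (INR j * al)); auto.
  - cbn [INR]. now apply Rmult_lt_0_compat.
  - split; cbn; ring.
  - split.
    + rewrite Ex. field. lra.
    + rewrite Ey. replace be with (2 * INR j / T) by (rewrite <- Bj; field; lra).
      replace al with (2 * INR i / T) by (rewrite <- Ai; field; lra).
      field. lra.
Qed.

Theorem mainTheorem3 :
  exists v : nat -> pt,
    simple_polygon 22 v /\
    exists x y : pt,
      in_interior 22 v x /\ in_interior 22 v y /\ x <> y /\
      ~ illuminates 22 v x y.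
Proof.
  exists gon22. split; [exact gon22_simple|].
  exists (0, 0), (2, 2).
  split; [exact source_interior|]. split; [exact target_interior|].
  split; [intros [= H _]; lra|].
  intros [ms [Hs Hr]].
  destruct ms as [|p ms]; cbn [app] in Hs, Hr.
  - now apply (trajectory_misses_target (2, 2) [] Hs Hr).
  - apply (trajectory_misses_target p (ms ++ [(2, 2)]) Hs Hr).
    apply last_last.
Qed.
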